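(* Let $f:\mathbb{R}\to\mathbb{R}$ be an $S$-map with $f(0)=0$, and consider the delay differential equation $$x'(t)=f(x(t-1)).\qquad ( * )$$ Then: (a) If $|f'(0)|\le 3/2$, then $\lim_{t\to\infty}x(t)=0$ for every solution $x(t)$ of $( * )$. (b) If $|f'(0)|>3/2$, then $$\alpha\le\liminf_{t\to\infty}x(t)\le\limsup_{t\to\infty}x(t)\le\beta$$ for every solution $x(t)$ of $( * )$, where $\{\alpha,\beta\}$, $\alpha<\beta$, is the unique $2$-cycle of $f$.
   Context: For a $C^3$ map $f$, the Schwarzian derivative is $(Sf)(x)=\frac{f'''(x)}{f'(x)}-\frac32\left(\frac{f''(x)}{f'(x)}\right)^2$ whenever $f'(x)\neq 0$. A map $f:I\to I$ ($I$ a real interval) is an $S$-map if it is three times differentiable, and $(Sf)(x)<0$ and $f'(x)<0$ for all $x\in I$; if $I=\mathbb{R}$, it is also assumed that at least one of the limits $f(-\infty)=\lim_{x\to-\infty}f(x)$ and $f(\infty)=\lim_{x\to\infty}f(x)$ is finite. A $2$-cycle of $f$ is a set $\{\alpha,\beta\}$ with $\alpha\ne\beta$, $f(\alpha)=\beta$ and $f(\beta)=\alpha$. A solution of $( * )$ is a continuous function $x:[t_0-1,\infty)\to\mathbb{R}$ (for some real $t_0$), determined by a continuous initial condition $x(t)=\varphi(t)$ on $[t_0-1,t_0]$, which is differentiable and satisfies $( * )$ for all $t>t_0$. *)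

(* Defs.v *)
From HB Require Import structures.
From mathcomp Require Import all_boot all_order all_algebra.
From mathcomp Require Import all_classical all_reals all_analysis.
Import Order.TTheory GRing.Theory Num.Theory.
Import numFieldNormedType.Exports.

Set Implicit Arguments.
Unset Strict Implicit.
Unset Printing Implicit Defensive.

Local Open Scope ring_scope.
Local Open Scope classical_set_scope.

Definition schwarzian (R : realType) (f : R -> R) (x : R) : R :=
  f^`(3)%classic x / f^`()%classic x -
    3 / 2 * (f^`(2)%classic x / f^`()%classic x) ^+ 2.

(* S-maps on the whole line, hence the finite-limit clause.  [f^`(n)] is a
   total function, so differentiability has to be required separately; the
   third derivative is not assumed to be continuous. *)
Definition S_map (R : realType) (f : R -> R) : Prop :=
  [/\ forall (n : nat) (x : R), (n < 3)%N -> derivable f^`(n)%classic x 1,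
      forall x : R, schwarzian f x < 0,
      forall x : R, f^`()%classic x < 0 &
      (exists l : R, f x @[x --> -oo] --> l) \/
      (exists l : R, f x @[x --> +oo] --> l)].

Definition two_cycle (R : realType) (f : R -> R) (A : set R) : Prop :=
  exists a b : R, [/\ a != b, f a = b, f b = a & A = [set a; b]].

(* Solutions of x'(t) = f (x (t - 1)) for t > t0.  The function x is total, but
   its values before t0 - 1 are unconstrained junk; the initial condition is
   the restriction of x to [t0 - 1, t0], where x is only continuous. *)
Definition delay_solution (R : realType) (f : R -> R) (t0 : R) (x : R -> R) :
    Prop :=
  {within `[t0 - 1, +oo[, continuous x} /\
  forall t : R, t0 < t -> is_derive t 1 x (f (x (t - 1))).

(* Main.v *)
(* A solution without arbitrarily late zeros is eventually monotone and tends
   to 0.  Otherwise let M = limsup x and - m = liminf x.  At a local maximum s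
   one has x (s - 1) = 0, so integrating the equation over [s - 2, s - 1] and
   [s - 1, s] bounds x s in terms of a lower bound of x.

   Crudely this gives M <= f (- m) and - m >= f M, hence M <= f (f M).  The
   function (- f')^(-1/2) is convex because Sf < 0, which forces every 2-cycle
   of f to have multiplier < 1; so f (f v) - v crosses zero exactly once on
   v > 0, and M is at most the positive point of the cycle.

   If |f' 0| <= 3/2, the same convexity puts f strictly inside the Moebius
   transformation r v = - 3/2 v / (1 + b v), b = f'' 0 / (2 |f' 0|), and by the
   reflection v |-> - f (- v) one may take b >= 0.  With f replaced by r, the
   two-step integration yields m <= M / (1 + 4/3 b M) and, if m > 0,
   M < m / (1 - 4/3 b m).  The two right-hand sides are inverse to each other,
   so m = M = 0. *)
Require Import Defs.
From HB Require Import structures.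
From mathcomp Require Import all_boot all_order all_algebra.
From mathcomp Require Import all_classical all_reals all_analysis.
From mathcomp Require Import ring lra.
Import Order.TTheory GRing.Theory Num.Theory.
Import numFieldNormedType.Exports.

Set Implicit Arguments.
Unset Strict Implicit.
Unset Printing Implicit Defensive.

Local Open Scope ring_scope.
Local Open Scope classical_set_scope.

(** * One-variable calculus *)

Section Calculus.
Context {R : realType}.
Implicit Types (f g u : R -> R) (x a b c : R).

Lemma is_derive_funD f g x a b : is_derive x 1 f a -> is_derive x 1 g b ->
  is_derive x 1 (fun y => f y + g y) (a + b).
Proof. by move=> df dg; apply: is_deriveD. Qed.

Lemma is_derive_funN f x a : is_derive x 1 f a ->
  is_derive x 1 (fun y => - f y) (- a).
Proof. by move=> df; apply: is_deriveN. Qed.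

Lemma is_derive_funM f g x a b : is_derive x 1 f a -> is_derive x 1 g b ->
  is_derive x 1 (fun y => f y * g y) (f x * b + g x * a).
Proof. by move=> df dg; apply: is_deriveM. Qed.

Lemma is_derive_funV f x a : f x != 0 -> is_derive x 1 f a ->
  is_derive x 1 (fun y => (f y)^-1) (- (f x) ^- 2 * a).
Proof. exact: is_deriveV. Qed.

Lemma is_derive_fun_comp f g x a b : is_derive (g x) 1 f a ->
  is_derive x 1 g b -> is_derive x 1 (fun y => f (g y)) (a * b).
Proof. by move=> df dg; apply: (is_derive1_comp df dg). Qed.

Lemma is_derive_fun_id x : is_derive x 1 (fun y : R => y) 1.
Proof. exact: is_derive_id. Qed.

Lemma is_derive_fun_cst c x : is_derive x 1 (fun _ : R => c) 0.
Proof. exact: is_derive_cst. Qed.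

Lemma is_derive_continuous f x a : is_derive x 1 f a -> {for x, continuous f}.
Proof.
by move=> [df _]; apply/differentiable_continuous/derivable1_diffP.
Qed.

Lemma is_derive_within f (df : R -> R) a b :
  (forall t, a <= t <= b -> is_derive t 1 f (df t)) ->
  {within `[a, b], continuous f}.
Proof.
move=> H; apply: derivable_within_continuous => t; rewrite in_itv /= => tab.
by have [] := H t tab.
Qed.

Lemma mean_value f (df : R -> R) a b : a < b ->
  (forall t, a <= t <= b -> is_derive t 1 f (df t)) ->
  exists2 c, a < c < b & f b - f a = df c * (b - a).
Proof.
move=> ab H; have Hoo t : t \in `]a, b[%R -> is_derive t 1 f (df t).
  by rewrite in_itv /= => /andP[ta tb]; apply: H; rewrite !ltW.
have [c] := MVT ab Hoo (is_derive_within H).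
by rewrite in_itv /= => cab E; exists c.
Qed.

Lemma derive_ge0_le f (df : R -> R) a b : a <= b ->
  (forall t, a <= t <= b -> is_derive t 1 f (df t)) ->
  (forall t, a < t < b -> 0 <= df t) -> f a <= f b.
Proof.
rewrite le_eqVlt => /predU1P[->//|ab] H H0.
have [c cab E] := mean_value ab H.
by rewrite -subr_ge0 E mulr_ge0 ?H0// subr_ge0 ltW.
Qed.

Lemma derive_gt0_lt f (df : R -> R) a b : a < b ->
  (forall t, a <= t <= b -> is_derive t 1 f (df t)) ->
  (forall t, a < t < b -> 0 < df t) -> f a < f b.
Proof.
move=> ab H H0; have [c cab E] := mean_value ab H.
by rewrite -subr_gt0 E mulr_gt0 ?H0// subr_gt0.
Qed.

(** Eventual bounds are available only for levels above the limsup; this carries an inequality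
    between such levels down to the limsup itself. *)
Lemma ge_continuous_right (h : R -> R) p c : {for p, continuous h} ->
  (exists2 d, p < d & forall y, p < y < d -> c <= h y) -> c <= h p.
Proof.
move=> ch [d pd H]; rewrite leNgt; apply/negP => hc.
have e0 : 0 < c - h p by rewrite subr_gt0.
have /cvgrPdist_lt/(_ _ e0)[r /= r0 Hr] := ch.
pose e := Num.min (r / 2) ((d - p) / 2).
have e1 : 0 < e by rewrite lt_min; apply/andP; split; lra.
have e2 : e <= r / 2 by rewrite ge_min lexx.
have e3 : e <= (d - p) / 2 by rewrite ge_min lexx orbT.
have := Hr (p + e); rewrite /= opprD addNKr normrN gtr0_norm //.
move=> /(_ ltac:(lra)); have := H (p + e) ltac:(apply/andP; split; lra).
rewrite ltr_norml => ? /andP[]; lra.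
Qed.

End Calculus.

(** The rules above are stated for pointwise lambda terms so that they match by shape here.
    [notypeclasses refine] turns their derivative premises into goals; nonvanishing conditions
    absent from the context are left over. *)
Ltac solve_derive :=
  repeat first
    [ eassumption
    | notypeclasses refine (is_derive_fun_cst _ _)
    | notypeclasses refine (is_derive_fun_id _)
    | notypeclasses refine (is_derive_funN _)
    | notypeclasses refine (is_derive_funD _ _)
    | notypeclasses refine (is_derive_funM _ _)
    | notypeclasses refine (is_derive_funV _ _) ].

Ltac derive_ring :=
  notypeclasses refine (is_derive_eq _ _);
  [solve_derive | rewrite /GRing.scale /=; ring].

(** * Zeros crossed downwards *)

Section FirstZero.
Context {R : realType}.
Implicit Types (h dh : R -> R).

Lemma derive_lt0_crossing h (p d : R) : is_derive p 1 h d -> d < 0 ->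
  exists2 r, 0 < r & forall t, 0 < t < r -> h (p + t) < h p < h (p - t).
Proof.
move=> [dh hE] d0.
have /cvgrPdist_lt /(_ (- d)) := dh.
rewrite oppr_gt0 => /(_ d0)[r /= r0 Hr]; exists r => // t /andP[t0 tr].
have Hq e : `|e| < r -> e != 0 -> (h (p + e) - h p) / e < 0.
  move=> er en0; have := Hr e; rewrite /= sub0r normrN => /(_ er en0).
  rewrite -/('D_1 h p) hE /= ltr_norml => /andP[+ _].
  rewrite /GRing.scale /= mulr1 [e + p]addrC [e^-1 * _]mulrC; lra.
have := Hq t; rewrite gtr0_norm// gt_eqF// => /(_ tr isT).
rewrite pmulr_llt0 ?invr_gt0// subr_lt0 => ->.
have := Hq (- t); rewrite normrN gtr0_norm// oppr_eq0 gt_eqF// => /(_ tr isT).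
by rewrite nmulr_llt0 ?invr_lt0 ?oppr_lt0// subr_gt0.
Qed.

(* Otherwise the first zero of h beyond p would be an upcrossing. *)
Lemma downcrossing_lt0 h dh (p s : R) : p < s ->
  (forall t, p <= t <= s -> is_derive t 1 h (dh t)) ->
  (forall t, p <= t <= s -> h t = 0 -> dh t < 0) -> h p = 0 -> h s < 0.
Proof.
move=> ps dhE dh0 hp; rewrite ltNge; apply/negP => hs.
have pI : p <= p <= s by rewrite lexx ltW.
have [r r0 Hr] := derive_lt0_crossing (dhE p pI) (dh0 p pI hp).
(* h is negative just after p, so the infimum z of A is at least p + r. *)
pose A := [set t | p < t <= s /\ 0 <= h t].
have Ar t : A t -> p + r <= t.
  move=> [/andP[pt _] ht]; rewrite leNgt; apply/negP => tr.
  have /Hr : 0 < t - p < r by lra.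
  by rewrite addrC subrK hp; lra.
have hA : has_inf A by split; [exists s; split; lra|exists (p + r)].
pose z := inf A.
have prz : p + r <= z by apply: lb_le_inf => //; case: hA.
have zs : z <= s by apply: ge_inf; [case: hA|split; lra].
have zI : p <= z <= s by lra.
have hz : 0 <= h z.
  rewrite leNgt; apply/negP => hz.
  have /cvgrPdist_lt /(_ (- h z)) := is_derive_continuous (dhE z zI).
  rewrite oppr_gt0 => /(_ hz)[e /= e0 He].
  have [t At tz] := inf_adherent e0 hA.
  have zt : z <= t by apply: ge_inf => //; case: hA.
  have := He t; rewrite /= ltr_norml ltr_norml.
  move=> /(_ ltac:(rewrite -/z in tz; lra)).
  by case: At => _ ht; lra.
(* Either z is a downcrossing or h z > 0; in both cases h >= 0 just left of z, against the
   minimality of z. Below, t <= r / 2 keeps z - t beyond p. *)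
have [e e0 He] : exists2 e, 0 < e & forall t, 0 < t < e -> 0 <= h (z - t).
  have [hz0|hz0] := eqVneq (h z) 0.
    have [e e0 He] := derive_lt0_crossing (dhE z zI) (dh0 z zI hz0).
    by exists e => // t /He; rewrite hz0; lra.
  have hz1 : 0 < h z by rewrite lt_def hz0.
  have /cvgrPdist_lt /(_ _ hz1)[e /= e0 He] := is_derive_continuous (dhE z zI).
  exists e => // t te; have := He (z - t).
  by rewrite /= !ltr_norml => /(_ ltac:(lra)); lra.
pose t := Num.min (e / 2) (r / 2).
have t0 : 0 < t by rewrite lt_min; apply/andP; split; lra.
have te : t <= e / 2 by rewrite ge_min lexx.
have tr : t <= r / 2 by rewrite ge_min lexx orbT.
have : z <= z - t.
  apply: ge_inf; first by case: hA.
  by split; [lra|apply: He; lra].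
lra.
Qed.

End FirstZero.

(** * The delay equation *)

Section Delay.
Context {R : realType}.
Implicit Types (f x Q : R -> R) (T C p q h K M : R).

Definition decreasing_at0 f := (forall u v : R, u < v -> f v < f u) /\ f 0 = 0.

Definition dde f (t0 : R) x :=
  forall t : R, t0 < t -> is_derive t 1 x (f (x (t - 1))).

Definition eventually_le x C := exists T : R, forall t : R, T <= t -> x t <= C.

(** If x solves the equation of f, then - x solves that of [reflect_fun f]; lower bounds on x thus
    follow from upper bounds on - x. *)
Definition reflect_fun f : R -> R := fun v => - f (- v).

Lemma decreasing_at0_le f (u v : R) : decreasing_at0 f -> u <= v -> f v <= f u.
Proof. by move=> [fd _]; rewrite le_eqVlt => /predU1P[->//|/fd/ltW]. Qed.

Lemma decreasing_at0_lt0 f (v : R) : decreasing_at0 f -> 0 < v -> f v < 0.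
Proof. by move=> [fd f0] /fd; rewrite f0. Qed.

Lemma decreasing_at0_gt0 f (v : R) : decreasing_at0 f -> v < 0 -> 0 < f v.
Proof. by move=> [fd f0] /fd; rewrite f0. Qed.

Lemma decreasing_at0_reflect f :
  decreasing_at0 f -> decreasing_at0 (reflect_fun f).
Proof.
move=> [fd f0]; split; last by rewrite /reflect_fun oppr0 f0 oppr0.
by move=> u v uv; rewrite ltrN2; apply: fd; rewrite ltrN2.
Qed.

Lemma dde_reflect f (t0 : R) x : dde f t0 x ->
  dde (reflect_fun f) t0 (fun t => - x t).
Proof. by move=> H t /H dx; rewrite /reflect_fun opprK; exact: is_deriveN. Qed.

Lemma eventually_leW x C D : C <= D -> eventually_le x C -> eventually_le x D.
Proof. by move=> CD [T H]; exists T => t /H /le_trans; apply. Qed.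

(* If x vanishes at s - 1 then x >= - q * (s - 1 - t) on [s - 2, s - 1], so
   that the slope of x on [s - 1, s] is at most f (- q * (s - t)) <= dQ _. *)
Lemma peak_le f (t0 : R) x T p q h Q (dQ : R -> R) (s : R) :
  decreasing_at0 f -> dde f t0 x -> t0 < T ->
  (forall t : R, T <= t -> f (x t) <= p) -> p <= q -> 0 < q -> 0 <= h <= q ->
  (forall v : R, 0 <= v <= h -> is_derive v 1 Q (dQ v)) ->
  (forall v : R, 0 <= v <= h -> f (- v) <= dQ v) ->
  T + 3 <= s -> x (s - 1) = 0 ->
  x s <= p * (1 - h / q) + (Q h - Q 0) / q.
Proof.
move=> fd dx t0T fp pq q0 /andP[h0 hq] dQE fQ Ts xs0.
(* Slopes on [s - 2, s - 1] involve x on [s - 3, s - 2], whence the margin T + 3. *)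
have low (t : R) : s - 2 <= t <= s - 1 -> - (q * (s - 1 - t)) <= x t.
  move=> /andP[t1 t2].
  have := @derive_ge0_le _ (fun r => q * r + - x r)
    (fun r => q - f (x (r - 1))) t (s - 1) t2.
  rewrite xs0 => H; suff : q * t + - x t <= q * (s - 1) + - 0 by lra.
  apply: H => r /andP[r1 r2].
    have dxr := dx r ltac:(lra).
    by derive_ring.
  by have := fp (r - 1) ltac:(lra); lra.
have hq0 : 0 <= h / q by rewrite divr_ge0// ltW.
have hq1 : h / q <= 1 by rewrite ler_pdivrMr// mul1r.
have hqE : q * (h / q) = h by rewrite mulrC divfK// gt_eqF.
(* The interval [s - 1, s] is split at c: before c the slope is bounded by p, after c by dQ (q * (s
   - r)), whose argument runs from h down to 0. *)
set k := h / q in hq0 hq1 hqE *; pose c := s - k.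
have upc : x c <= p * (1 - k).
  have := @derive_ge0_le _ (fun r => p * r + - x r)
    (fun r => p - f (x (r - 1))) (s - 1) c ltac:(rewrite /c; lra).
  rewrite xs0 => H.
  suff : p * (s - 1) + - 0 <= p * c + - x c by rewrite /c; lra.
  apply: H => r /andP[r1 r2].
    have dxr := dx r ltac:(lra).
    by derive_ring.
  by have := fp (r - 1) ltac:(lra); lra.
have := @derive_ge0_le _ (fun r => - (Q (q * (s + - r)) * q^-1) + - x r)
    (fun r => dQ (q * (s - r)) - f (x (r - 1))) c s ltac:(rewrite /c; lra).
rewrite subrr mulr0 (_ : s + - c = k); last by rewrite /c; ring.
rewrite hqE => H.
suff : - (Q h * q^-1) + - x c <= - (Q 0 * q^-1) + - x s.
  by rewrite mulrBl; lra.
have vP (r : R) : c <= r <= s -> 0 <= q * (s - r) <= h.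
  move=> /andP[r1 r2]; rewrite mulr_ge0 ?subr_ge0 ?(ltW q0)//=.
  by rewrite -hqE ler_pM2l//; move: r1; rewrite /c; lra.
apply: H => r /[dup] /andP[r1 r2] rI.
  have dxr : is_derive r 1 x (f (x (r - 1))).
    by apply: dx; rewrite /c in r1; lra.
  have dq : is_derive r 1 (fun r : R => q * (s + - r)) (- q).
    by derive_ring.
  have dQr := @is_derive_fun_comp _ Q (fun r : R => q * (s - r)) r _ _
    (dQE _ (vP r rI)) dq.
  notypeclasses refine (is_derive_eq _ _); first by solve_derive.
  by rewrite /GRing.scale /=; field; rewrite gt_eqF.
have rI' : c <= r <= s by rewrite !ltW.
have := fQ _ (vP r rI').
have : f (x (r - 1)) <= f (- (q * (s - r))).
  apply: (decreasing_at0_le fd).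
  have := low (r - 1); rewrite (_ : s - 1 - (r - 1) = s - r); last by ring.
  by apply; rewrite /c in r1; lra.
lra.
Qed.

(** Between two late zeros, a positive maximum at c is interior, so x (c - 1) = 0 and the peak bound
    applies. Without late zeros x has constant sign: if negative there is nothing to do, and if
    positive x decreases and cannot stay above C, since its slope would be at most f C < 0. *)
Lemma peaks_eventually_le f (t0 : R) x C : decreasing_at0 f ->
  dde f t0 x -> 0 < C ->
  (exists T : R, forall s : R, T <= s -> x (s - 1) = 0 -> x s <= C) ->
  eventually_le x C.
Proof.
move=> fd dx C0 [T HT].
pose T' := Num.max T (t0 + 1).
have TT' : T <= T' by rewrite le_max lexx.
have t0T' : t0 + 1 <= T' by rewrite le_max lexx orbT.
have cx (a b : R) : T' <= a -> {within `[a, b], continuous x}.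
  move=> Ta; apply: (is_derive_within (df := fun t => f (x (t - 1)))) => t ?.
  by apply: dx; lra.
have [zeros|nozero] :=
    pselect (forall t, exists2 z, t <= z & x z = 0).
  have [z0 T0 xz0] := zeros T'.
  exists z0 => t z0t; rewrite leNgt; apply/negP => Cxt.
  have [z1 tz1 xz1] := zeros t.
  have z01 : z0 <= z1 := le_trans z0t tz1.
  have [c] := EVT_max z01 (cx _ _ T0).
  rewrite in_itv /= => /andP[c0 c1] cmax.
  have xtc : x t <= x c by apply: cmax; rewrite in_itv /= z0t.
  have xc0 : 0 < x c by lra.
  have z0c : z0 < c.
    rewrite lt_neqAle c0 andbT.
    by apply: contraTneq xc0 => <-; rewrite xz0 ltxx.
  have cz1 : c < z1.
    rewrite lt_neqAle c1 andbT.
    by apply: contraTneq xc0 => ->; rewrite xz1 ltxx.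
  have dxc : is_derive c 1 x (f (x (c - 1))) by apply: dx; lra.
  have dxc0 : is_derive c 1 x 0.
    apply: (derive1_at_max z01).
    - move=> r; rewrite in_itv /= => ?.
      by have [] := dx r ltac:(lra).
    - by rewrite in_itv /= z0c.
    - move=> r; rewrite in_itv /= => ?; apply: cmax.
      by rewrite in_itv /= !ltW //; lra.
  have fx0 : f (x (c - 1)) = 0.
    rewrite -(@derive_val _ _ _ _ _ _ _ dxc).
    exact: (@derive_val _ _ _ _ _ _ _ dxc0).
  have : x (c - 1) = 0.
    have [||//] := ltgtP (x (c - 1)) 0.
    - by move/(decreasing_at0_gt0 fd); rewrite fx0 ltxx.
    - by move/(decreasing_at0_lt0 fd); rewrite fx0 ltxx.
  by move/(HT c ltac:(lra)); lra.
have [T1 nz] : exists T1, forall t, T1 <= t -> x t <> 0.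
  move/existsNP: nozero => [T1 H]; exists T1 => t T1t xt0.
  by apply: H; exists t.
pose T2 := Num.max T1 T'.
have T12 : T1 <= T2 by rewrite le_max lexx.
have T'2 : T' <= T2 by rewrite le_max lexx orbT.
have [[t T2t xt]|allpos] := pselect (exists2 t, T2 <= t & x t <= 0).
  exists t => r tr; rewrite leNgt; apply/negP => Cxr.
  have [||z] := @IVT _ x t r 0 tr; first by apply: cx; lra.
    by rewrite ge_min le_max xt /= (ltW (lt_trans C0 Cxr)) orbT.
  by rewrite in_itv /= => zt; apply: nz; lra.
have pos (t : R) : T2 <= t -> 0 < x t.
  by move=> tT; rewrite ltNge; apply/negP => ?; apply: allpos; exists t.
have [[t T2t xt]|allbig] := pselect (exists2 t, T2 + 1 <= t & x t <= C).
  exists t => r tr; apply: le_trans xt.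
  rewrite -lerN2.
  apply: (@derive_ge0_le _ (fun r => - x r)
    (fun t => - f (x (t - 1))) t r) => // z zI.
    by apply: is_deriveN; apply: dx; lra.
  by rewrite oppr_ge0 ltW// (decreasing_at0_lt0 fd)// pos//; lra.
have big (t : R) : T2 + 1 <= t -> C < x t.
  by move=> tT; rewrite ltNge; apply/negP => ?; apply: allbig; exists t.
exfalso.
have fC : f C < 0 := decreasing_at0_lt0 fd C0.
(* b is where the line of slope f C through (a, x a) reaches 0; x lies below that line, yet x b >
   0. *)
pose a := T2 + 2; pose b := a + x a / - f C.
have xa : 0 < x a by apply: pos; rewrite /a; lra.
have ab : a <= b by rewrite /b lerDl divr_ge0 ?oppr_ge0// ltW.
have : f C * a + - x a <= f C * b + - x b.
  apply: (@derive_ge0_le _ (fun r => f C * r + - x r)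
    (fun t => f C - f (x (t - 1))) a b) => // z zI.
    have dxz : is_derive z 1 x (f (x (z - 1))).
      by apply: dx; rewrite /a in zI; lra.
    by derive_ring.
  rewrite subr_ge0; apply: (decreasing_at0_le fd); apply/ltW/big.
  by rewrite /a in zI; lra.
have -> : f C * b = f C * a - x a by rewrite /b; field; rewrite lt_eqF.
have := pos b ltac:(rewrite /a in ab; lra).
lra.
Qed.

(** After a zero at s - 1 the slope is at most p for one unit of time: this is [peak_le] with h =
    0. *)
Lemma slope_eventually_le f (t0 : R) x p : decreasing_at0 f ->
  dde f t0 x -> 0 < p ->
  eventually_le (fun t => f (x t)) p -> eventually_le x p.
Proof.
move=> fd dx p0 [T HT]; apply: (peaks_eventually_le fd dx p0).
pose T' := Num.max T (t0 + 1).
have TT' : T <= T' by rewrite le_max lexx.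
have t0T' : t0 + 1 <= T' by rewrite le_max lexx orbT.
exists (T' + 3) => s Ts xs0.
have := @peak_le f t0 x T' p p 0 (fun=> 0) (fun=> 0) s fd dx.
rewrite mul0r subr0 mulr1 subrr mul0r addr0; apply => //.
- lra.
- by move=> t T't; apply: HT; lra.
- by rewrite lexx ltW.
- move=> v /le_anti <-; rewrite oppr0; case: fd => _ -> //.
Qed.

(** M is max (limsup x, 0), obtained as the infimum of the nonnegative eventual bounds. *)
Lemma eventually_le_inf x C : eventually_le x C ->
  exists M, [/\ 0 <= M, forall K : R, M < K -> eventually_le x K &
    forall K : R, 0 <= K -> eventually_le x K -> M <= K].
Proof.
move=> xC; pose A := [set K | 0 <= K /\ eventually_le x K].
have A0 : lbound A 0 by move=> K [].
have hA : has_inf A.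
  split; last by exists 0.
  exists (Num.max C 0); split; first by rewrite le_max lexx orbT.
  by apply: eventually_leW xC; rewrite le_max lexx.
exists (inf A); split.
- by apply: lb_le_inf => //; case: hA.
- move=> K; rewrite -subr_gt0 => /inf_adherent -/(_ _ hA)[e [_ xe]].
  by rewrite addrC subrK => /ltW eK; apply: eventually_leW xe.
- by move=> K K0 xK; apply: ge_inf; [exists 0|].
Qed.

(** Slopes are at most l, so x <= l eventually; then slopes are at least f l, which bounds - x by -
    f l. *)
Lemma eventually_bounded f (t0 : R) x l : decreasing_at0 f -> dde f t0 x ->
  (forall v : R, f v <= l) ->
  (exists C, eventually_le x C) /\ (exists C, eventually_le (fun t => - x t) C).
Proof.
move=> fd dx fl.
have l0 : 0 < l.
  apply: lt_le_trans (fl (-1)).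
  by apply: (decreasing_at0_gt0 fd); rewrite ltrN10.
have xl : eventually_le x l.
  by apply: (slope_eventually_le fd dx l0); exists 0 => t _; apply: fl.
split; first by exists l.
exists (- f l).
apply: (slope_eventually_le (decreasing_at0_reflect fd) (dde_reflect dx)).
  by rewrite oppr_gt0 (decreasing_at0_lt0 fd).
have [T HT] := xl; exists T => t /HT xt.
by rewrite /reflect_fun opprK lerN2 (decreasing_at0_le fd).
Qed.

End Delay.

(** * Limsup, liminf and limit at infinity from eventual bounds *)

Section LimitsAtInfinity.
Context {R : realType}.
Implicit Types x : R -> R.

Lemma limf_esup_le x (b : R) : (forall K, b < K -> eventually_le x K) ->
  (limf_esup (fun t => (x t)%:E) +oo%R <= b%:E)%E.
Proof.
move=> xK; apply/lee_addgt0Pr => e e0.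
have [T HT] := xK (b + e) ltac:(lra).
apply: le_trans (_ : ereal_sup [set (x t)%:E | t in `[T, +oo[] <= _)%E.
  apply: ereal_inf_lbound; exists `[T, +oo[ => //.
  by exists T; split; [exact: num_real|move=> t Tt; rewrite /= in_itv/= ltW].
apply: ge_ereal_sup => _ [t + <-]; rewrite /= in_itv/= andbT => /HT.
by rewrite -EFinD lee_fin.
Qed.

Lemma limf_einf_ge x (a : R) :
  (forall K, - a < K -> eventually_le (fun t => - x t) K) ->
  (a%:E <= limf_einf (fun t => (x t)%:E) +oo%R)%E.
Proof.
by move=> /limf_esup_le; rewrite /limf_einf leeNr.
Qed.

(** Two members of the filter at infinity always meet, and a common point separates the infimum over
    one from the supremum over the other. *)
Lemma limf_einf_le_esup x :
  (limf_einf (fun t => (x t)%:E) +oo%R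
    <= limf_esup (fun t => (x t)%:E) +oo%R)%E.
Proof.
rewrite limf_einfE limf_esupE; apply: ge_ereal_sup => _ [A FA <-].
apply: le_ereal_inf_tmp => _ [B FB <-].
have /(@filter_ex _ _ _)[t [At Bt]] : (+oo%R : set_system R) (A `&` B).
  exact: filterI.
apply: (@le_trans _ _ (x t)%:E).
  by apply: ereal_inf_lbound; exists t.
by apply: ereal_sup_ubound; exists t.
Qed.

Lemma eventually_le_cvg0 x :
  (forall K, 0 < K -> eventually_le x K /\ eventually_le (fun t => - x t) K) ->
  x t @[t --> +oo] --> (0 : R).
Proof.
move=> xK; apply/cvgrPdist_le => e e0; have [[T HT] [S HS]] := xK e e0.
near=> t; rewrite sub0r normrN ler_norml lerNl HS ?HT//; near: t;
  exact: nbhs_pinfty_ge (num_real _).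
Unshelve. all: by end_near. Qed.

End LimitsAtInfinity.

(** * Comparison with a Moebius transformation and convergence to 0 *)

Section Contraction.
Context {R : realType}.
Implicit Types (f x : R -> R) (b c C p q h K M : R).

(** For r v = - 3/2 v / (1 + b v), [moebius b K] is r (- K) and [moebius (- b) K] is - r K. *)
Definition moebius c K : R := 3 / 2 * K / (1 - c * K).

(* A logarithm-free majorant of the primitive of moebius c that vanishes at 0,
   with the same Taylor expansion up to K ^+ 3 included. *)
Definition moebius_prim c K : R := K * K * (3 - c * K) / (4 * (1 - c * K)).

(** The bound of [peak_le] for p = [moebius c K], h = K and Q = [moebius_prim c]. *)
Definition peak_bound c K q : R :=
  moebius c K * (1 - K / q) + moebius_prim c K / q.

Lemma level_le_image f (t0 : R) x K : decreasing_at0 f -> dde f t0 x -> 0 < K ->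
  eventually_le (fun t => - x t) K -> eventually_le x (f (- K)).
Proof.
move=> fd dx K0 [T HT]; apply: (slope_eventually_le fd dx).
  by rewrite (decreasing_at0_gt0 fd)// oppr_lt0.
by exists T => t /HT xt; apply: (decreasing_at0_le fd); rewrite lerNl.
Qed.

(** The slope bound q may exceed f (- K): [peak_le] with h = K requires K <= q, which f (- K) itself
    need not satisfy. *)
Lemma peak_bound_eventually_le f (t0 : R) x c K q : decreasing_at0 f ->
  dde f t0 x -> 0 < K -> c * K < 1 ->
  (forall v : R, 0 <= v <= K -> f (- v) <= moebius c v) ->
  K <= q -> f (- K) <= q -> eventually_le (fun t => - x t) K ->
  eventually_le x (peak_bound c K q).
Proof.
move=> fd dx K0 cK fm Kq fq [T0 HT0].
have q0 : 0 < q by lra.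
have Kq1 : K / q <= 1 by rewrite ler_pdivrMr// mul1r.
have m0 : 0 < moebius c K by rewrite divr_gt0 ?mulr_gt0//; lra.
apply: (peaks_eventually_le fd dx).
  apply: ltr_wpDl; first by rewrite mulr_ge0 ?(ltW m0)// subr_ge0.
  by rewrite divr_gt0// divr_gt0 ?mulr_gt0//; lra.
pose T := Num.max T0 (t0 + 1).
have TT : T0 <= T by rewrite le_max lexx.
have t0T : t0 + 1 <= T by rewrite le_max lexx orbT.
have cv (v : R) : 0 <= v <= K -> 0 < 1 - c * v.
  move=> /andP[v0 vK]; have [c0|c0] := leP c 0.
    by have : c * v <= 0 := mulr_le0_ge0 c0 v0; lra.
  have : c * v <= c * K by rewrite ler_pM2l.
  by lra.
exists (T + 3) => s Ts xs0.
have := @peak_le _ f t0 x T (f (- K)) q K (moebius_prim c)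
  (fun v => (6 * v - 6 * c * v ^+ 2 + 2 * c ^+ 2 * v ^+ 3) /
    (4 * (1 - c * v) ^+ 2)) s fd dx.
move=> /(_ ltac:(lra)) H; apply: le_trans (H _ fq q0 _ _ _ Ts xs0) _.
- move=> t Tt; apply: (decreasing_at0_le fd).
  by rewrite lerNl; apply: HT0; lra.
- by rewrite (ltW K0).
- move=> v vK; have nz := lt0r_neq0 (cv v vK).
  notypeclasses refine (is_derive_eq _ _).
    by solve_derive; rewrite mulf_neq0.
  by rewrite /GRing.scale /=; field.
- move=> v vK; apply: le_trans (fm v vK) _.
  have cv0 := cv v vK; case/andP: vK => v0 _.
  rewrite -subr_ge0 (_ : _ - _ = c ^+ 2 * v ^+ 3 / (2 * (1 - c * v) ^+ 2)).
    by rewrite divr_ge0// mulr_ge0 ?sqr_ge0 ?exprn_ge0//.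
  by rewrite /moebius; field; rewrite gt_eqF.
rewrite /peak_bound [moebius_prim c 0]/moebius_prim !mul0r subr0 lerD2r.
by rewrite ler_wpM2r ?subr_ge0// fm// lexx ltW.
Qed.

(* 3 v ^ 2 / (2 (2 + c v)) majorizes the primitive of moebius (- c) too; it is
   worse near 0 but sharp enough for 2 c K >= 1. *)
Lemma far_bound_eventually_le f (t0 : R) x c K q : decreasing_at0 f ->
  dde f t0 x -> 0 <= c -> 0 < q ->
  (forall v : R, 0 <= v <= q -> f (- v) <= moebius (- c) v) ->
  f (- K) <= q -> eventually_le (fun t => - x t) K ->
  eventually_le x (3 * q / (2 * (2 + c * q))).
Proof.
move=> fd dx c0 q0 fm fq [T0 HT0].
have cv (v : R) : 0 <= v -> 0 <= c * v by move=> ?; rewrite mulr_ge0.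
apply: (peaks_eventually_le fd dx).
  by rewrite divr_gt0 ?mulr_gt0//; have := cv q (ltW q0); lra.
pose T := Num.max T0 (t0 + 1).
have TT : T0 <= T by rewrite le_max lexx.
have t0T : t0 + 1 <= T by rewrite le_max lexx orbT.
exists (T + 3) => s Ts xs0.
(* With h = q the term p * (1 - h / q) of [peak_le] vanishes and only Q q / q remains. *)
have := @peak_le _ f t0 x T q q q (fun v => 3 * (v * v) / (2 * (2 + c * v)))
  (fun v => 3 * v * (4 + c * v) / (2 * (2 + c * v) ^+ 2)) s fd dx.
move=> /(_ ltac:(lra)) H.
apply: le_trans (H _ (lexx q) q0 _ _ _ Ts xs0) _.
- move=> t Tt; apply: le_trans fq; apply: (decreasing_at0_le fd).
  by rewrite lerNl; apply: HT0; lra.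
- by rewrite lexx ltW.
- move=> v /andP[/cv v0 _]; have nz : 2 + c * v != 0 by apply: lt0r_neq0; lra.
  notypeclasses refine (is_derive_eq _ _).
    by solve_derive; rewrite mulf_neq0.
  by rewrite /GRing.scale /=; field.
- move=> v vK; apply: le_trans (fm v vK) _.
  case/andP: vK => v0 _; have := cv v v0 => cv0.
  rewrite -subr_ge0 (_ : _ - _ =
    3 * v * (c * v) / (2 * (2 + c * v) ^+ 2 * (1 + c * v))).
    by rewrite divr_ge0 ?mulr_ge0 ?sqr_ge0//; lra.
  by rewrite /moebius; field; apply/andP; split; apply: lt0r_neq0; lra.
have := cv q (ltW q0) => cq0.
rewrite le_eqVlt; apply/orP; left; apply/eqP.
by field; rewrite gt_eqF//=; lra.
Qed.

(** The right-hand side is K / (1 - 4/3 c K); c = - b and c = b give the two mutually inverse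
    bounds. The range of c K keeps 5 + 4 c K >= 0 and 3 - 4 c K > 0 in the factored difference. *)
Lemma peak_bound_moebius_le c K : 0 < K -> - (5 / 4) <= c * K < 3 / 4 ->
  peak_bound c K (moebius c K) <= 3 * K / (3 - 4 * (c * K)).
Proof.
move=> K0 /andP[cK1 cK2]; rewrite -subr_ge0.
rewrite (_ : _ - _ = K * (c * K) ^+ 2 * (5 + 4 * (c * K)) /
  (6 * (1 - c * K) * (3 - 4 * (c * K)))).
  apply: divr_ge0; last by rewrite !mulr_ge0//; lra.
  by apply: mulr_ge0 (mulr_ge0 (ltW K0) (sqr_ge0 _)) _; lra.
rewrite /peak_bound /moebius_prim /moebius; field.
by do !(apply/andP; split); apply: lt0r_neq0; lra.
Qed.

(** The coefficient of 1 / q in [peak_bound] is [moebius_prim c K] - K * [moebius c K] < 0. This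
    turns the strict gap between f and the Moebius map into a strict inequality of levels. *)
Lemma peak_bound_lt c K p q : 0 < K -> 0 <= c -> c * K < 1 -> 0 < p -> p < q ->
  peak_bound c K p < peak_bound c K q.
Proof.
move=> K0 c0 cK p0 pq; rewrite -subr_gt0.
have cK0 : 0 <= c * K by rewrite mulr_ge0// ltW.
rewrite (_ : _ - _ = K * K * (3 + c * K) * (q - p) /
   (4 * (1 - c * K) * p * q)).
  by rewrite divr_gt0 ?mulr_gt0//; lra.
rewrite /peak_bound /moebius_prim /moebius; field.
by do !(apply/andP; split); apply: lt0r_neq0; lra.
Qed.

Lemma lower_level_eventually_le f (t0 : R) x b K : decreasing_at0 f ->
  dde f t0 x -> 0 <= b -> (forall v : R, 0 <= v -> - f v <= moebius (- b) v) ->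
  0 < K -> eventually_le x K ->
  eventually_le (fun t => - x t) (3 * K / (3 + 4 * (b * K))).
Proof.
move=> fd dx b0 fm K0 [T HT].
have bK0 : 0 <= b * K by rewrite mulr_ge0// ltW.
have gd := decreasing_at0_reflect fd; have dy := dde_reflect dx.
have gm (v : R) : 0 <= v -> reflect_fun f (- v) <= moebius (- b) v.
  by rewrite /reflect_fun opprK; exact: fm.
have yK : eventually_le (fun t => - - x t) K.
  by exists T => t; rewrite opprK; exact: HT.
pose q := moebius (- b) K.
have q0 : 0 < q by rewrite divr_gt0 ?mulr_gt0//; lra.
(* 2 b K <= 1 is equivalent to K <= q, the range where [peak_bound] applies; beyond it q < K and
   [peak_le] is used with h = q. *)
have [bK|bK] := leP (2 * (b * K)) 1.
  have Kq : K <= q.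
    rewrite -subr_ge0 (_ : _ - _ = K * (1 - 2 * (b * K)) / (2 * (1 + b * K))).
      by rewrite divr_ge0 ?mulr_ge0//; lra.
    by rewrite /q /moebius; field; apply: lt0r_neq0; lra.
  have yle : eventually_le (fun t => - x t) (peak_bound (- b) K q).
    apply: (peak_bound_eventually_le gd dy) => //; first lra.
    - by move=> v /andP[v0 _]; exact: gm.
    - by apply: gm; exact: ltW.
  apply: eventually_leW yle; have := @peak_bound_moebius_le (- b) K K0.
  by rewrite mulNr mulrN opprK; apply; lra.
have := @far_bound_eventually_le _ t0 _ b K q gd dy b0 q0.
move=> /(_ _ (gm K (ltW K0)) yK) yle.
apply: (eventually_leW _ (yle _)); last by move=> v /andP[v0 _]; exact: gm.
rewrite -subr_ge0 (_ : _ - _ = 3 * K * (2 * (b * K) - 1) /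
  (2 * (4 + 7 * (b * K)) * (3 + 4 * (b * K)))).
  by rewrite divr_ge0 ?mulr_ge0//; lra.
rewrite /q /moebius; field.
by do !(apply/andP; split); apply: lt0r_neq0; lra.
Qed.

Lemma derivable_comp_opp f (v : R) : (forall u : R, derivable f u 1) ->
  exists d, is_derive v 1 (fun u : R => f (- u)) d.
Proof.
move=> df; have dN : is_derive v 1 (fun u : R => - u) (- 1) by solve_derive.
have dfv := derivableP (df (- v)).
by eexists; exact: (@is_derive_fun_comp _ f _ v _ _ dfv dN).
Qed.

(** Let K decrease to m in [level_le_image]. *)
Lemma upper_level_le f (t0 : R) x m M : decreasing_at0 f ->
  (forall v : R, derivable f v 1) -> dde f t0 x -> 0 <= m ->
  (forall K : R, m < K -> eventually_le (fun t => - x t) K) ->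
  (forall K : R, 0 <= K -> eventually_le x K -> M <= K) -> M <= f (- m).
Proof.
move=> fd df dx m0 mK Mmin.
have [d dfm] := derivable_comp_opp m df.
apply: (@ge_continuous_right _ (fun K => f (- K))).
  exact: is_derive_continuous dfm.
exists (m + 1); first by lra.
move=> K /andP[mltK _]; have K0 : 0 < K by lra.
apply: Mmin; first by rewrite ltW// (decreasing_at0_gt0 fd)// oppr_lt0.
by apply: (level_le_image fd dx K0); exact: mK.
Qed.

Lemma contraction_cvg0 f (t0 : R) x b C : decreasing_at0 f ->
  (forall v : R, derivable f v 1) -> dde f t0 x ->
  0 <= b -> (forall v : R, 0 <= v -> - f v <= moebius (- b) v) ->
  (forall v : R, 0 < v -> b * v < 1 -> f (- v) < moebius b v) ->
  eventually_le x C -> eventually_le (fun t => - x t) C ->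
  forall K, 0 < K -> eventually_le x K /\ eventually_le (fun t => - x t) K.
Proof.
move=> fd df dx b0 fm1 fm2 /eventually_le_inf[M [M0 MK Mmin]].
move=> /eventually_le_inf[m [m0 mK mmin]].
have bM0 : 0 <= b * M by rewrite mulr_ge0.
have bm0 : 0 <= b * m by rewrite mulr_ge0.
have mM : m <= 3 * M / (3 + 4 * (b * M)).
  have nz : 3 + 4 * (b * M) != 0 by apply: lt0r_neq0; lra.
  apply: (@ge_continuous_right _ (fun K => 3 * K / (3 + 4 * (b * K)))).
    by notypeclasses refine (is_derive_continuous _); solve_derive.
  exists (M + 1); first by lra.
  move=> K /andP[MltK _]; have K0 : 0 < K by lra.
  have bK0 : 0 <= b * K by rewrite mulr_ge0// ltW.
  apply: mmin; first by rewrite divr_ge0 ?mulr_ge0//; lra.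
  by apply: (lower_level_eventually_le fd dx b0 fm1) => //; exact: MK.
have Mfm : M <= f (- m) := upper_level_le fd df dx m0 mK Mmin.
have [m00|m_gt0] : m = 0 \/ 0 < m by lra.
  have M00 : M = 0.
    apply/le_anti; rewrite M0 andbT.
    by move: Mfm; rewrite m00 oppr0; case: fd => _ ->.
  by move=> K K0; split; [apply: MK; rewrite M00|apply: mK; rewrite m00].
exfalso.
have mM' : m * (3 + 4 * (b * M)) <= 3 * M by rewrite -ler_pdivlMr//; lra.
have mleM : m <= M.
  have : 0 <= m * (b * M) by rewrite mulr_ge0.
  by lra.
(* Because b m <= 3 b M / (3 + 4 b M) < 3 / 4. *)
have bm34 : b * m < 3 / 4.
  rewrite ltNge; apply/negP => bm.
  have := ler_wpM2l b0 mM'.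
  have : 3 / 4 * (3 + 4 * (b * M)) <= b * m * (3 + 4 * (b * M)).
    by apply: ler_wpM2r => //; lra.
  lra.
have mfm : m <= f (- m) by lra.
(* Since m <= f (- m) <= f (- K) for K > m, adding K - m makes the slope bound at least K, and it
   tends to f (- m) as K decreases to m. *)
pose h K := peak_bound b K (f (- K) + (K - m)).
have hM : M <= h m.
  have [d dfm] := derivable_comp_opp m df.
  have nz1 : 1 - b * m != 0 by apply: lt0r_neq0; lra.
  have nz2 : f (- m) + (m - m) != 0 by apply: lt0r_neq0; lra.
  apply: (@ge_continuous_right _ h).
    rewrite /h /peak_bound /moebius /moebius_prim.
    notypeclasses refine (is_derive_continuous _).
    by solve_derive; rewrite ?mulf_neq0.
  (* This radius keeps b K < 3 / 4; the denominator b + 1 also covers b = 0. *)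
  exists (m + (3 / 4 - b * m) / (b + 1)).
    by rewrite ltrDl divr_gt0//; lra.
  move=> K /andP[mltK Klt]; have K0 : 0 < K by lra.
  have bK : b * K < 3 / 4.
    have : (b + 1) * (K - m) < 3 / 4 - b * m.
      by rewrite mulrC -ltr_pdivlMr; lra.
    nra.
  have fmK : f (- m) <= f (- K).
    by apply: (decreasing_at0_le fd); rewrite lerN2 ltW.
  have bK0 : 0 <= b * K by rewrite mulr_ge0// ltW.
  have q1 : K <= f (- K) + (K - m) by lra.
  apply: Mmin.
    apply: addr_ge0; apply: mulr_ge0;
      rewrite ?invr_ge0 ?divr_ge0 ?mulr_ge0//; try lra.
    by rewrite subr_ge0 ler_pdivrMr ?mul1r//; lra.
  apply: (peak_bound_eventually_le fd dx K0) => //; try lra.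
    move=> v /andP[]; rewrite le_eqVlt => /predU1P[<- _|v0 vK].
      by rewrite oppr0 /moebius mulr0 mul0r; case: fd => _ ->.
    apply/ltW/fm2 => //; have : b * v <= b * K by rewrite ler_wpM2l.
    by lra.
  exact: mK.
have hlt : h m < 3 * m / (3 - 4 * (b * m)).
  apply: lt_le_trans (peak_bound_moebius_le m_gt0 _); last by lra.
  rewrite /h subrr addr0.
  by apply: peak_bound_lt => //; [lra|lra|apply: fm2 => //; lra].
(* This is [mM] solved for M; it contradicts M <= h m < 3 m / (3 - 4 b m). *)
have : 3 * m / (3 - 4 * (b * m)) <= M by rewrite ler_pdivrMr; lra.
lra.
Qed.

End Contraction.

(** * Negative Schwarzian derivative *)

Section NegativeSchwarzian.
Context {R : realType} (f f1 f2 f3 : R -> R).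
Hypothesis df : forall x : R, is_derive x 1 f (f1 x).
Hypothesis df1 : forall x : R, is_derive x 1 f1 (f2 x).
Hypothesis df2 : forall x : R, is_derive x 1 f2 (f3 x).
Hypothesis f1_lt0 : forall x : R, f1 x < 0.
Hypothesis Sf_lt0 : forall x : R, f3 x / f1 x - 3 / 2 * (f2 x / f1 x) ^+ 2 < 0.

(* This solution of y'' = - (Sf / 2) * y is convex since Sf < 0. *)
Definition inv_sqrt_slope (x : R) : R := (Num.sqrt (- f1 x))^-1.

Definition inv_sqrt_slope' (x : R) : R := f2 x / 2 * inv_sqrt_slope x ^+ 3.

Definition inv_sqrt_slope'' (x : R) : R :=
  f3 x / 2 * inv_sqrt_slope x ^+ 3 + 3 / 4 * f2 x ^+ 2 * inv_sqrt_slope x ^+ 5.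

Local Notation phi := inv_sqrt_slope.
Local Notation phi' := inv_sqrt_slope'.
Local Notation phi'' := inv_sqrt_slope''.

Lemma inv_sqrt_slope_gt0 (x : R) : 0 < phi x.
Proof. by rewrite invr_gt0 sqrtr_gt0 oppr_gt0. Qed.

Lemma slopeE (x : R) : f1 x = - (phi x ^+ 2)^-1.
Proof. by rewrite exprVn invrK sqr_sqrtr ?opprK// oppr_ge0 ltW. Qed.

Lemma is_derive_inv_sqrt_slope (x : R) : is_derive x 1 phi (phi' x).
Proof.
have s0 : 0 < - f1 x by rewrite oppr_gt0.
have ds := @is_derive_fun_comp _ Num.sqrt (fun y => - f1 y) x _ _
  (is_derive1_sqrt s0) (is_derive_funN (df1 x)).
have nz : Num.sqrt (- f1 x) != 0 by rewrite gt_eqF// sqrtr_gt0.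
have dV := @is_derive_funV _ (fun y => Num.sqrt (- f1 y)) x _ nz ds.
apply: (@is_derive_eq _ _ _ _ _ _ _ _ dV).
by rewrite /phi' /phi; field.
Qed.

Lemma is_derive_inv_sqrt_slope' (x : R) : is_derive x 1 phi' (phi'' x).
Proof.
have dphi := is_derive_inv_sqrt_slope x; have df2x := df2 x.
notypeclasses refine (is_derive_eq _ _).
  rewrite /inv_sqrt_slope'.
  rewrite (_ : (fun x0 : R => _) =
      (fun y => f2 y * 2^-1 * (phi y * phi y * phi y))).
    by solve_derive.
  by apply/funext => y; ring.
by rewrite /GRing.scale /= /phi'' /phi'; field.
Qed.

Lemma inv_sqrt_slope''_gt0 (x : R) : 0 < phi'' x.
Proof.
have p0 := inv_sqrt_slope_gt0 x; have := Sf_lt0 x; rewrite slopeE => S0.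
rewrite (_ : phi'' x = phi x / 2 * - (f3 x / - (phi x ^+ 2)^-1 -
  3 / 2 * (f2 x / - (phi x ^+ 2)^-1) ^+ 2)).
  by rewrite mulr_gt0 ?divr_gt0// oppr_gt0.
by rewrite /phi''; field; rewrite gt_eqF.
Qed.

Lemma inv_sqrt_slope'_lt (x y : R) : x < y -> phi' x < phi' y.
Proof.
move=> xy.
apply: (derive_gt0_lt xy (fun t _ => is_derive_inv_sqrt_slope' t)) => t _.
exact: inv_sqrt_slope''_gt0.
Qed.

Lemma inv_sqrt_slope_tangent (x : R) : x != 0 -> phi 0 + phi' 0 * x < phi x.
Proof.
have [x0|x0|//] := ltgtP x 0 => _.
- have [c /andP[_ c0]] := mean_value x0 (fun t _ => is_derive_inv_sqrt_slope t).
  rewrite sub0r mulrN => E; have := inv_sqrt_slope'_lt c0.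
  rewrite -(ltr_nM2r x0); lra.
- have [c /andP[c0 _]] := mean_value x0 (fun t _ => is_derive_inv_sqrt_slope t).
  rewrite subr0 => E; have := inv_sqrt_slope'_lt c0.
  rewrite -(ltr_pM2r x0); lra.
Qed.

(* v |-> - a v / (1 + b v) is the Moebius transformation with the 2-jet of f
   at 0. *)
Let a := - f1 0.
Let b := f2 0 / (2 * a).

(** The tangent of the strictly convex [phi] at 0 is phi 0 * (1 + b x). Where it is positive, taking
    inverse squares compares f' with the derivative of the Moebius map. *)
Lemma slope_gt (x : R) : x != 0 -> 0 < 1 + b * x ->
  - (a / (1 + b * x) ^+ 2) < f1 x.
Proof.
move=> x0 bx; rewrite slopeE ltrN2.
have p0 := inv_sqrt_slope_gt0 0; have px := inv_sqrt_slope_gt0 x.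
have aE : a = (phi 0 ^+ 2)^-1 by rewrite /a slopeE opprK.
have tx : phi 0 * (1 + b * x) < phi x.
  suff -> : phi 0 * (1 + b * x) = phi 0 + phi' 0 * x.
    exact: inv_sqrt_slope_tangent.
  by rewrite /b aE /phi'; field; rewrite gt_eqF.
rewrite aE -invfM ltf_pV2 ?posrE ?mulr_gt0 ?exprn_gt0// -exprMn.
by rewrite ltr_pXn2r// nnegrE ltW// mulr_gt0.
Qed.

Hypothesis f0 : f 0 = 0.

Let is_derive_gap (x : R) : 0 < 1 + b * x ->
  is_derive x 1 (fun y => f y + a * y / (1 + b * y))
    (f1 x + a / (1 + b * x) ^+ 2).
Proof.
move=> bx; have nz : 1 + b * x != 0 by rewrite gt_eqF.
have dfx := df x.
notypeclasses refine (is_derive_eq _ _); first by solve_derive.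
by rewrite /GRing.scale /=; field.
Qed.

Let gap0 : f 0 + a * 0 / (1 + b * 0) = 0.
Proof. by rewrite f0 mulr0 mul0r addr0. Qed.

(** The gap between f and its Moebius map vanishes at 0 and increases by [slope_gt]; the same
    argument left of 0 gives [moebius_gt_neg]. *)
Lemma moebius_gt_pos (v : R) : 0 < v -> 0 < 1 + b * v ->
  - f v < a * v / (1 + b * v).
Proof.
move=> v0 bv.
have bt (t : R) : 0 <= t <= v -> 0 < 1 + b * t.
  move=> /andP[t0 tv]; have [b0|b0] := leP 0 b.
    by have : 0 <= b * t := mulr_ge0 b0 t0; lra.
  have : b * v <= b * t by rewrite ler_nM2l.
  by lra.
have : f 0 + a * 0 / (1 + b * 0) < f v + a * v / (1 + b * v).
  apply: (derive_gt0_lt v0 (fun t tI => is_derive_gap (bt t tI))) => t.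
  move=> /andP[t1 t2].
  rewrite -ltrBlDr sub0r; apply: slope_gt; first by rewrite gt_eqF.
  by apply: bt; rewrite !ltW.
by rewrite gap0; lra.
Qed.

Lemma moebius_gt_neg (v : R) : 0 < v -> 0 < 1 - b * v ->
  f (- v) < a * v / (1 - b * v).
Proof.
move=> v0 bv.
have bt (t : R) : - v <= t <= 0 -> 0 < 1 + b * t.
  move=> /andP[t0 tv]; have [b0|b0] := leP b 0.
    by have : 0 <= b * t := mulr_le0 b0 tv; lra.
  have : b * - v <= b * t by rewrite ler_pM2l.
  by lra.
have vn0 : - v < 0 by rewrite oppr_lt0.
have : f (- v) + a * (- v) / (1 + b * (- v)) < f 0 + a * 0 / (1 + b * 0).
  apply: (derive_gt0_lt vn0 (fun t tI => is_derive_gap (bt t tI))) => t.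
  move=> /andP[t1 t2].
  rewrite -ltrBlDr sub0r; apply: slope_gt; first by rewrite lt_eqF.
  by apply: bt; rewrite !ltW.
by rewrite gap0 !mulrN mulNr; lra.
Qed.

(** y t = (f u - f t) * phi t solves the same linear equation y'' = - (Sf / 2) y as [phi], hence is
    convex right of u. As y u = 0 and y' u = 1 / phi u, it lies above (t - u) / phi u. *)
Lemma secant_gt (u v : R) : u < v -> v - u < (f u - f v) * phi u * phi v.
Proof.
move=> uv.
pose y (t : R) := (f u - f t) * phi t.
pose y' (t : R) := (phi t)^-1 + (f u - f t) * phi' t.
have dy (t : R) : is_derive t 1 y (y' t).
  have dphi := is_derive_inv_sqrt_slope t; have dft := df t.
  notypeclasses refine (is_derive_eq _ _); first by rewrite /y; solve_derive.
  rewrite /GRing.scale /= /y' slopeE; field.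
  by rewrite gt_eqF// inv_sqrt_slope_gt0.
have dy' (t : R) : is_derive t 1 y' ((f u - f t) * phi'' t).
  have dphi := is_derive_inv_sqrt_slope t.
  have dphi' := is_derive_inv_sqrt_slope' t.
  have dft := df t; have nz : phi t != 0 by rewrite gt_eqF// inv_sqrt_slope_gt0.
  notypeclasses refine (is_derive_eq _ _); first by rewrite /y'; solve_derive.
  by rewrite /GRing.scale /= slopeE; field.
have fdec (s t : R) : s < t -> f t < f s.
  move=> st; rewrite -ltrN2.
  apply: (derive_gt0_lt st (fun r _ => is_derive_funN (df r))) => r _.
  by rewrite oppr_gt0.
have [c /andP[uc cv]] := mean_value uv (fun t _ => dy t).
have : y' u < y' c.
  apply: (derive_gt0_lt uc (fun t _ => dy' t)) => t /andP[ut _].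
  by rewrite mulr_gt0 ?inv_sqrt_slope''_gt0// subr_gt0 fdec.
rewrite {1}/y' subrr mul0r addr0 {2}/y subrr mul0r subr0 => yc E.
have p0 := inv_sqrt_slope_gt0 u.
rewrite -(ltr_pM2r (_ : 0 < (phi u)^-1)); last by rewrite invr_gt0.
rewrite (_ : _ * phi u * phi v * _ = y v); last first.
  by rewrite /y; field; rewrite gt_eqF.
by rewrite E mulrC ltr_pM2r// subr_gt0.
Qed.

(** The secant through a 2-cycle has slope - 1, so [secant_gt] reads 1 < phi u * phi v, and the
    multiplier is (phi u * phi v)^(-2). *)
Lemma two_cycle_multiplier_lt1 (u v : R) : u < v -> f u = v -> f v = u ->
  f1 u * f1 v < 1.
Proof.
move=> uv fu fv; have := secant_gt uv; rewrite fu fv -mulrA => H.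
have {}H : 1 < phi u * phi v.
  by rewrite -(ltr_pM2l (_ : 0 < v - u)) ?subr_gt0// mulr1.
rewrite !slopeE mulrNN -invfM -exprMn invf_lt1 ?exprn_gt0//; last by lra.
by rewrite expr_gt1//; lra.
Qed.

End NegativeSchwarzian.

(** * Application to S-maps: convergence, the 2-cycle and its interval *)

Section SMaps.
Context {R : realType}.
Implicit Types f x : R -> R.

Lemma S_map_derive f : S_map f ->
  [/\ forall x : R, is_derive x 1 f (f^`()%classic x),
      forall x : R, is_derive x 1 f^`()%classic (f^`(2)%classic x) &
      forall x : R, is_derive x 1 f^`(2)%classic (f^`(3)%classic x)].
Proof.
move=> [df _ _ _]; split=> x.
- by have /derivableP := df 0%N x isT; rewrite -derive1E.
- by have /derivableP := df 1%N x isT; rewrite -derive1E.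
- by have /derivableP := df 2%N x isT; rewrite -derive1E.
Qed.

Lemma S_map_decreasing_at0 f : S_map f -> f 0 = 0 -> decreasing_at0 f.
Proof.
move=> fS f0; split=> // u v uv; have [df _ _] := S_map_derive fS.
have [_ _ f1_lt0 _] := fS; rewrite -ltrN2.
apply: (derive_gt0_lt uv (fun t _ => is_derive_funN (df t))) => t _.
by rewrite oppr_gt0.
Qed.

Lemma S_map_bounded f : S_map f -> f 0 = 0 ->
  (exists l, forall v, f v <= l) \/ (exists l, forall v, l <= f v).
Proof.
move=> fS f0; have fd := S_map_decreasing_at0 fS f0.
have [_ _ _ [[l fl]|[l fl]]] := fS; [left|right]; exists l => v.
- apply: (cvgr_to_ge fl); near=> t; apply: (decreasing_at0_le fd); near: t.
  exact: nbhs_ninfty_le (num_real _).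
- apply: (cvgr_to_le fl); near=> t; apply: (decreasing_at0_le fd); near: t.
  exact: nbhs_pinfty_ge (num_real _).
Unshelve. all: by end_near. Qed.

Lemma dde_bounded f (t0 : R) x : decreasing_at0 f -> dde f t0 x ->
  (exists l, forall v, f v <= l) \/ (exists l, forall v, l <= f v) ->
  exists C, eventually_le x C /\ eventually_le (fun t => - x t) C.
Proof.
move=> fd dx fb.
suff [[C1 H1] [C2 H2]] : (exists C, eventually_le x C) /\
    (exists C, eventually_le (fun t => - x t) C).
  exists (Num.max C1 C2); split.
    by apply: eventually_leW H1; rewrite le_max lexx.
  by apply: eventually_leW H2; rewrite le_max lexx orbT.
case: fb => [[l fl]|[l fl]]; first exact: eventually_bounded fd dx fl.
have gl v : reflect_fun f v <= - l by rewrite lerN2.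
have [H1 [C [T HT]]] :=
  eventually_bounded (decreasing_at0_reflect fd) (dde_reflect dx) gl.
by split=> //; exists C, T => t /HT; rewrite opprK.
Qed.

Lemma S_map_cvg0 f (t0 : R) x : S_map f -> f 0 = 0 ->
  `|f^`()%classic 0| <= 3 / 2 -> dde f t0 x -> x t @[t --> +oo] --> (0 : R).
Proof.
move=> fS f0 a32 dx; apply: eventually_le_cvg0.
have fd := S_map_decreasing_at0 fS f0.
have [C [xC yC]] := dde_bounded fd dx (S_map_bounded fS f0).
have [df df1 df2] := S_map_derive fS; have [_ Sf f1_lt0 _] := fS.
have dfv (v : R) : derivable f v 1 by have [] := df v.
set a := - f^`()%classic 0; pose b := f^`(2)%classic 0 / (2 * a).
have a32' : a <= 3 / 2 by rewrite ltr0_norm in a32.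
have Hpos := moebius_gt_pos df df1 df2 f1_lt0 Sf f0.
have Hneg := moebius_gt_neg df df1 df2 f1_lt0 Sf f0.
(* The bound on f' 0 enters here: a is enlarged to 3/2. *)
have le_moebius c v : 0 <= v -> 0 < 1 - c * v ->
    a * v / (1 - c * v) <= moebius c v.
  by move=> v0 cv; rewrite ler_wpM2r ?invr_ge0 ?(ltW cv)// ler_wpM2r.
have Bpos v : 0 < v -> 0 < 1 + b * v -> - f v < moebius (- b) v.
  move=> v0 bv; apply: lt_le_trans (Hpos v v0 bv) _.
  by have := le_moebius (- b) v (ltW v0); rewrite mulNr opprK; exact.
have Bneg v : 0 < v -> 0 < 1 - b * v -> f (- v) < moebius b v.
  move=> v0 bv; apply: lt_le_trans (Hneg v v0 bv) _.
  exact: le_moebius (ltW v0) bv.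
have [b0|b0] := leP 0 b.
  apply: (contraction_cvg0 fd dfv dx b0 _ _ xC yC) => v v0.
    move: v0; rewrite le_eqVlt => /predU1P[<-|v0].
      by rewrite f0 oppr0 /moebius mulr0 mul0r.
    by apply/ltW/Bpos => //; have : 0 <= b * v := mulr_ge0 b0 (ltW v0); lra.
  by move=> bv; apply: Bneg => //; lra.
(* For b < 0 reflection replaces b by - b and exchanges [Bpos] and [Bneg]. *)
have b0' : 0 <= - b by lra.
have dgv (v : R) : derivable (reflect_fun f) v 1.
  have [d dfN] := derivable_comp_opp v dfv.
  by have [] := is_derive_funN dfN.
have zC : eventually_le (fun t => - - x t) C.
  by have [T HT] := xC; exists T => t /HT; rewrite opprK.
have H := contraction_cvg0 (decreasing_at0_reflect fd) dgv (dde_reflect dx) b0'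
  _ _ yC zC.
move=> K K0; suff [yK [T HT]] : eventually_le (fun t => - x t) K /\
    eventually_le (fun t => - - x t) K.
  by split=> //; exists T => t /HT; rewrite opprK.
apply: H K0 => v v0.
  rewrite /reflect_fun !opprK; move: v0; rewrite le_eqVlt => /predU1P[<-|v0].
    by rewrite oppr0 f0 /moebius mulr0 mul0r.
  apply/ltW/Bneg => //; have : b * v <= 0 := mulr_le0_ge0 (ltW b0) (ltW v0).
  by lra.
by move=> bv; rewrite /reflect_fun opprK; apply: Bpos => //; lra.
Qed.

(** On v > 0 every zero of f (f v) - v is a downcrossing, so there is at most one. One exists
    because the function is positive just right of 0 and negative far out. *)
Lemma S_map_two_cycle f : S_map f -> f 0 = 0 -> 3 / 2 < `|f^`()%classic 0| ->
  exists b : R, [/\ 0 < b, f (f b) = b,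
    forall v, 0 < v -> f (f v) = v -> v = b & forall v, b < v -> f (f v) < v].
Proof.
move=> fS f0 a32; have fd := S_map_decreasing_at0 fS f0.
have [df df1 df2] := S_map_derive fS; have [_ Sf f1_lt0 _] := fS.
pose h v := f (f v) + - v.
pose dh v := f^`()%classic (f v) * f^`()%classic v + - 1.
have dhE (v : R) : is_derive v 1 h (dh v).
  have dff := @is_derive_fun_comp _ f f v _ _ (df (f v)) (df v).
  by notypeclasses refine (is_derive_eq _ _); [rewrite /h; solve_derive|].
(* Since f v < 0 < v, such a zero gives a genuine 2-cycle. *)
have dh0 v : 0 < v -> h v = 0 -> dh v < 0.
  move=> v0 /subr0_eq ffv; have fv0 := decreasing_at0_lt0 fd v0.
  rewrite subr_lt0.
  by apply: (two_cycle_multiplier_lt1 df df1 df2 f1_lt0 Sf) => //; lra.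
have down p s : 0 < p -> p < s -> h p = 0 -> h s < 0.
  move=> p0 ps; apply: (downcrossing_lt0 ps (fun t _ => dhE t)) => t.
  by move=> /andP[pt _]; apply: dh0; lra.
(* h' 0 = (f' 0)^2 - 1 > 0. *)
have [e e0 he] : exists2 e, 0 < e & 0 < h e.
  have dhN : - dh 0 < 0.
    rewrite oppr_lt0 /dh f0 -expr2 -sqrrN subr_gt0.
    by rewrite ltr0_norm// in a32; rewrite expr_gt1//; lra.
  have [r r0 Hr] := derive_lt0_crossing (is_derive_funN (dhE 0)) dhN.
  exists (r / 2); first by lra.
  have /Hr/andP[+ _] : 0 < r / 2 < r by lra.
  by rewrite ltrN2 /h add0r f0 f0 subr0.
have [l fl] : exists l, forall v, f (f v) <= l.
  have [[l fl]|[l fl]] := S_map_bounded fS f0; first by exists l => v.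
  by exists (f l) => v; apply: decreasing_at0_le.
have el : e <= l + 1 by have := fl e; rewrite /h in he; lra.
have hl : h (l + 1) < 0 by have := fl (l + 1); rewrite /h; lra.
have [|b] := @IVT _ h e (l + 1) 0 el (is_derive_within (fun t _ => dhE t)).
  by rewrite ge_min le_max (ltW he) (ltW hl) orbT.
rewrite in_itv /= => /andP[eb _] hb; have b0 : 0 < b by lra.
exists b; split=> //; first exact: subr0_eq.
- move=> v v0 ffv; have hv : h v = 0 by rewrite /h ffv subrr.
  have [vb|bv|//] := ltgtP v b.
  + by have := down v b v0 vb hv; rewrite hb ltxx.
  + by have := down b v b0 bv hb; rewrite hv ltxx.
- by move=> v bv; rewrite -subr_lt0; exact: down b0 bv hb.
Qed.

(** f reverses signs, so every 2-cycle has a positive point, which must be b. *)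
Lemma S_map_two_cycle_unique f (b : R) : S_map f -> f 0 = 0 -> 0 < b ->
  f (f b) = b -> (forall v, 0 < v -> f (f v) = v -> v = b) ->
  forall A : set R, two_cycle f A <-> A = [set f b; b].
Proof.
move=> fS f0 b0 ffb ub A; have fd := S_map_decreasing_at0 fS f0.
split=> [[u [v [uv fu fv ->]]]|->].
  have [u0|u0|u0] := ltgtP u 0.
  - have vb : v = b by apply: ub; rewrite ?fv// -fu (decreasing_at0_gt0 fd).
    by rewrite -fv vb.
  - have ub' : u = b by apply: ub; rewrite // fu fv.
    by rewrite -fu ub' setUC.
  - by move: uv; rewrite -fu u0 f0 eqxx.
exists (f b), b; split=> //.
by rewrite lt_eqF// (lt_trans _ b0)// (decreasing_at0_lt0 fd).
Qed.

Lemma S_map_attracting_interval f (t0 : R) x (b : R) : S_map f -> f 0 = 0 ->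
  f (f b) = b -> (forall v, b < v -> f (f v) < v) -> dde f t0 x ->
  (forall K, b < K -> eventually_le x K) /\
  (forall K, - f b < K -> eventually_le (fun t => - x t) K).
Proof.
move=> fS f0 ffb hb dx; have fd := S_map_decreasing_at0 fS f0.
have [df _ _] := S_map_derive fS.
have dfv (v : R) : derivable f v 1 by have [] := df v.
have dgv (v : R) : derivable (reflect_fun f) v 1.
  have [d dfN] := derivable_comp_opp v dfv.
  by have [] := is_derive_funN dfN.
have [C [xC yC]] := dde_bounded fd dx (S_map_bounded fS f0).
have [M [M0 MK Mmin]] := eventually_le_inf xC.
have [m [m0 mK mmin]] := eventually_le_inf yC.
have Mm := upper_level_le fd dfv dx m0 mK Mmin.
have zK (K : R) : M < K -> eventually_le (fun t => - - x t) K.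
  by move=> /MK[T HT]; exists T => t /HT; rewrite opprK.
have := upper_level_le (decreasing_at0_reflect fd) dgv (dde_reflect dx)
  M0 zK mmin.
rewrite /reflect_fun opprK => mM.
(* M <= f (- m) and - m >= f M give M <= f (f M), which [hb] excludes for M > b. Then m <= - f M <=
   - f b. *)
have Mb : M <= b.
  rewrite leNgt; apply/negP => /hb ffM.
  have : f (- m) <= f (f M) by apply: (decreasing_at0_le fd); lra.
  lra.
split=> K bK; first by apply: MK; lra.
by apply: mK; have := decreasing_at0_le fd Mb; lra.
Qed.

End SMaps.

Unset Implicit Arguments.
Set Strict Implicit.
Set Printing Implicit Defensive.

Theorem proposition2 (R : realType) (f : R -> R) (fS : S_map f)
    (f0 : f 0 = 0) :
  (`|f^`()%classic 0| <= 3 / 2 ->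
     forall (t0 : R) (x : R -> R), delay_solution f t0 x ->
       x t @[t --> +oo] --> (0 : R)) /\
  (3 / 2 < `|f^`()%classic 0| ->
     exists a b : R,
       [/\ a < b,
           forall A : set R, two_cycle f A <-> A = [set a; b] &
           forall (t0 : R) (x : R -> R), delay_solution f t0 x ->
             [/\ (a%:E <= limf_einf (fun t => (x t)%:E) +oo%R)%E,
                 (limf_einf (fun t => (x t)%:E) +oo%R
                   <= limf_esup (fun t => (x t)%:E) +oo%R)%E &
                 (limf_esup (fun t => (x t)%:E) +oo%R <= b%:E)%E]]).
Proof.
split=> [a32 t0 x [_ dx]|a32]; first exact: S_map_cvg0 fS f0 a32 dx.
have [b [b0 ffb ub hb]] := S_map_two_cycle fS f0 a32.
exists (f b), b; split.
- rewrite (lt_trans _ b0)//.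
  exact: decreasing_at0_lt0 (S_map_decreasing_at0 fS f0) b0.
- exact: S_map_two_cycle_unique.
move=> t0 x [_ dx].
have [xb xfb] := S_map_attracting_interval fS f0 ffb hb dx.
by split; [exact: limf_einf_ge|exact: limf_einf_le_esup|exact: limf_esup_le].
Qed.
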